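(* Let $H$ and $K$ be Hopf algebras with $H$ cocommutative. Suppose that $K$ is an $H$-module bialgebra via an action $\rightharpoonup$. Let $\pi:H\to K$ be a Hopf algebra crossed homomorphism with respect to $\rightharpoonup$. Then $K$ has another $H$-module bialgebra structure via the derived action given by $$a\rightharpoonup_\pi x:=\mathrm{ad}_{\pi(a_1)}(a_2\rightharpoonup x),\quad\forall x\in K,\ a\in H.$$ Moreover, $S_K\circ\pi:H\to K$ is a Hopf algebra crossed homomorphism with respect to the new action $\rightharpoonup_\pi$.
   Context: Everything is over a field $\mathbf{k}$ of characteristic $0$. Sweedler notation: $\Delta(a)=a_1\otimes a_2$. $S_K$ is the antipode of $K$, and $\mathrm{ad}_x y=x_1yS_K(x_2)$ for $x,y\in K$ is the left adjoint action. $K$ is an $H$-module algebra via an algebra action $\rightharpoonup:H\to\mathrm{End}(K)$ if $a\rightharpoonup 1=\varepsilon(a)1$ and $a\rightharpoonup(xy)=(a_1\rightharpoonup x)(a_2\rightharpoonup y)$; it is an $H$-module bialgebra if moreover $\varepsilon_K(a\rightharpoonup x)=\varepsilon_H(a)\varepsilon_K(x)$ and $\Delta_K(a\rightharpoonup x)=(a_1\rightharpoonup x_1)\otimes(a_2\rightharpoonup x_2)$, for all $a\in H$, $x,y\in K$. A Hopf algebra crossed homomorphism $\pi:H\to K$ with respect to an action $\rightharpoonup$ is a coalgebra homomorphism with $\pi(ab)=\pi(a_1)(a_2\rightharpoonup\pi(b))$ for all $a,b\in H$. *)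

(* Defs.v *)
From HB Require Import structures.
From mathcomp Require Import all_boot all_algebra.
From mathcomp Require Import generic_quotient.
From mathcomp Require Import boolp.

Set Implicit Arguments.
Unset Strict Implicit.
Unset Printing Implicit Defensive.

Import GRing.Theory.
Local Open Scope ring_scope.
Local Open Scope quotient_scope.

Definition bilinear_map (R : comNzRingType) (U V W : lmodType R)
    (f : U -> V -> W) : Prop :=
  bilinear_for *:%R *:%R f.

(** A list [:: (u1, v1); ...; (un, vn)] stands for the formal sum of the
    symbols (ui, vi); [tens_eq] is the congruence generated by commutativity of
    formal sums and the bilinearity relations, and the tensor product is the
    quotient of the formal sums by it. *)
Section Tensor.
Variables (R : comNzRingType) (U V : lmodType R).

Inductive tens_eq : seq (U * V) -> seq (U * V) -> Prop :=
| tens_eq_refl s : tens_eq s s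
| tens_eq_sym s t : tens_eq s t -> tens_eq t s
| tens_eq_trans s t r : tens_eq s t -> tens_eq t r -> tens_eq s r
| tens_eq_cat s s' t t' :
    tens_eq s s' -> tens_eq t t' -> tens_eq (s ++ t) (s' ++ t')
| tens_eq_catC s t : tens_eq (s ++ t) (t ++ s)
| tens_eq_0l v : tens_eq [:: (0, v)] [::]
| tens_eq_Dl u u' v : tens_eq [:: (u + u', v)] [:: (u, v); (u', v)]
| tens_eq_Dr u v v' : tens_eq [:: (u, v + v')] [:: (u, v); (u, v')]
| tens_eq_Z c u v : tens_eq [:: (c *: u, v)] [:: (u, c *: v)].

Definition tens_rel (s t : seq (U * V)) : bool := `[< tens_eq s t >].

Lemma tens_rel_refl : reflexive tens_rel.
Proof. by move=> s; apply/asboolP; apply: tens_eq_refl. Qed.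

Lemma tens_rel_sym : symmetric tens_rel.
Proof.
by move=> s t; apply/asboolP/asboolP => h; apply: tens_eq_sym.
Qed.

Lemma tens_rel_trans : transitive tens_rel.
Proof.
move=> t s r /asboolP st /asboolP tr.
by apply/asboolP; apply: tens_eq_trans st tr.
Qed.

Canonical tens_equiv :=
  EquivRel tens_rel tens_rel_refl tens_rel_sym tens_rel_trans.

Definition tensor := {eq_quot tens_equiv}.
HB.instance Definition _ := Choice.on tensor.
HB.instance Definition _ := EqQuotient.on tensor.

Lemma tensorP (s t : seq (U * V)) :
  \pi_tensor s = \pi_tensor t <-> tens_eq s t.
Proof.
by split=> [/eqmodP/asboolP//|h]; apply/eqmodP/asboolP.
Qed.

Lemma tensorW (P : tensor -> Prop) :
  (forall s, P (\pi_tensor s)) -> forall t, P t.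
Proof. by move=> Ppi t; rewrite -[t]reprK. Qed.

Lemma tens_repr (s : seq (U * V)) : tens_eq (repr (\pi_tensor s)) s.
Proof. by apply/tensorP; rewrite reprK. Qed.

Definition tens_scale_seq (c : R) (s : seq (U * V)) : seq (U * V) :=
  [seq (c *: p.1, p.2) | p <- s].

Lemma tens_scale_seq_eq c s t :
  tens_eq s t -> tens_eq (tens_scale_seq c s) (tens_scale_seq c t).
Proof.
rewrite /tens_scale_seq; elim=> {s t} /=.
- by move=> s; apply: tens_eq_refl.
- by move=> s t _; apply: tens_eq_sym.
- by move=> s t r _ h _; apply: tens_eq_trans.
- by move=> s s' t t' _ h _ h'; rewrite !map_cat; apply: tens_eq_cat.
- by move=> s t; rewrite !map_cat; apply: tens_eq_catC.
- by move=> v; rewrite scaler0; apply: tens_eq_0l.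
- by move=> u u' v; rewrite scalerDr; apply: tens_eq_Dl.
- by move=> u v v'; apply: tens_eq_Dr.
- by move=> d u v; rewrite scalerA mulrC -scalerA; apply: tens_eq_Z.
Qed.

Definition tensor_zero : tensor := \pi_tensor [::].
Definition tensor_add (s t : tensor) : tensor := \pi_tensor (repr s ++ repr t).
Definition tensor_scale (c : R) (s : tensor) : tensor :=
  \pi_tensor (tens_scale_seq c (repr s)).
Definition tensor_opp (s : tensor) : tensor := tensor_scale (-1) s.

Lemma tensor_addE s t : tensor_add (\pi_tensor s) (\pi_tensor t) = \pi_tensor (s ++ t).
Proof. by apply/tensorP; apply: tens_eq_cat; apply: tens_repr. Qed.

Lemma tensor_scaleE c s :
  tensor_scale c (\pi_tensor s) = \pi_tensor (tens_scale_seq c s).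
Proof. by apply/tensorP; apply: tens_scale_seq_eq; apply: tens_repr. Qed.

Lemma tensor_addA : associative tensor_add.
Proof. by apply: tensorW => s; apply: tensorW => t; apply: tensorW => r; rewrite !tensor_addE catA. Qed.

Lemma tensor_addC : commutative tensor_add.
Proof.
by apply: tensorW => s; apply: tensorW => t; rewrite !tensor_addE; apply/tensorP/tens_eq_catC.
Qed.

Lemma tensor_add0 : left_id tensor_zero tensor_add.
Proof. by apply: tensorW => s; rewrite tensor_addE. Qed.

Lemma tensor_scaleDl_seq a b s :
  tens_eq (tens_scale_seq (a + b) s) (tens_scale_seq a s ++ tens_scale_seq b s).
Proof.
elim: s => [|[u v] s IH] /=; first exact: tens_eq_refl.
set As := tens_scale_seq a s; set Bs := tens_scale_seq b s.
apply: (@tens_eq_trans _ ([:: (a *: u, v); (b *: u, v)] ++ (As ++ Bs))).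
  apply: (@tens_eq_cat [:: _]) => //.
  by rewrite scalerDl; apply: tens_eq_Dl.
apply: (@tens_eq_cat [:: _] [:: _] ([:: (b *: u, v)] ++ (As ++ Bs))
                                   (As ++ ([:: (b *: u, v)] ++ Bs))).
  exact: tens_eq_refl.
rewrite !catA; apply: tens_eq_cat; first exact: tens_eq_catC.
exact: tens_eq_refl.
Qed.

Lemma tensor_scale0_seq s : tens_eq (tens_scale_seq 0 s) [::].
Proof.
elim: s => [|[u v] s IH] /=; first exact: tens_eq_refl.
rewrite -[[::]]/([::] ++ [::]) -[_ :: _]/([:: (0 *: u, v)] ++ _).
by apply: tens_eq_cat => //; rewrite scale0r; apply: tens_eq_0l.
Qed.

Lemma tensor_scale1 : left_id 1 tensor_scale.
Proof.
apply: tensorW => s; rewrite tensor_scaleE /tens_scale_seq; congr (\pi_tensor _).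
by elim: s => //= -[u v] s -> /=; rewrite scale1r.
Qed.

Lemma tensor_addN : left_inverse tensor_zero tensor_opp tensor_add.
Proof.
move=> t; rewrite /tensor_opp -{2}[t]tensor_scale1; move: t; apply: tensorW => s.
rewrite !tensor_scaleE tensor_addE; apply/tensorP.
apply: tens_eq_trans (tensor_scale0_seq s).
by apply: tens_eq_sym; rewrite -(addNr 1); apply: tensor_scaleDl_seq.
Qed.

HB.instance Definition _ := GRing.isZmodule.Build tensor
  tensor_addA tensor_addC tensor_add0 tensor_addN.

Lemma tensor_scaleA a b t :
  tensor_scale a (tensor_scale b t) = tensor_scale (a * b) t.
Proof.
move: t; apply: tensorW => s; rewrite !tensor_scaleE /tens_scale_seq -map_comp.
by congr (\pi_tensor _); apply: eq_map => -[u v] /=; rewrite scalerA.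
Qed.

Lemma tensor_scaleDr : right_distributive tensor_scale +%R.
Proof.
move=> c; apply: tensorW => s; apply: tensorW => t.
rewrite -![LHS]/(tensor_scale c (tensor_add _ _)) -![RHS]/(tensor_add _ _).
by rewrite !(tensor_addE, tensor_scaleE) /tens_scale_seq map_cat.
Qed.

Lemma tensor_scaleDl t : {morph tensor_scale^~ t : a b / a + b}.
Proof.
move=> a b; move: t; apply: tensorW => s; rewrite -[RHS]/(tensor_add _ _).
by rewrite !(tensor_addE, tensor_scaleE); apply/tensorP/tensor_scaleDl_seq.
Qed.

HB.instance Definition _ := GRing.Zmodule_isLmodule.Build R tensor
  tensor_scaleA tensor_scale1 tensor_scaleDr tensor_scaleDl.

Definition tens (u : U) (v : V) : tensor := \pi_tensor [:: (u, v)].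

(** The linear extension to the tensor product of a bilinear [f] (see
    [tlift_tens] and [tlift_linear]).  For an [f] that is not bilinear the value
    depends on the chosen representatives and is meaningless. *)
Definition tlift (W : lmodType R) (f : U -> V -> W) (t : tensor) : W :=
  \sum_(p <- repr t) f p.1 p.2.

End Tensor.

Notation "u ⊗ v" := (tens u v) (at level 40, left associativity) : ring_scope.

(** Sweedler notation: the value on [t] of the linear map sending x ⊗ y to E. *)
Notation "\swd_ ( x , y <- t ) E" := (tlift (fun x y => E) t)
  (at level 41, x name, y name, t at level 50, E at level 41,
   format "\swd_ ( x ,  y  <-  t )  E") : ring_scope.

Section TensorTheory.
Variables (R : comNzRingType) (U V : lmodType R).

Lemma tens_bilinear : bilinear_map (@tens R U V).
Proof.
split=> [v c u u'|u c v v'] /=; rewrite /tens.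
  rewrite -[RHS]/(tensor_add (tensor_scale _ _) _) tensor_scaleE tensor_addE.
  by apply/tensorP; apply: tens_eq_Dl.
rewrite -[RHS]/(tensor_add (tensor_scale _ _) _) tensor_scaleE tensor_addE.
apply/tensorP; apply: tens_eq_trans (tens_eq_Dr _ _ _) _.
apply: (@tens_eq_cat _ _ _ [:: _] _ [:: _]); last exact: tens_eq_refl.
by apply: tens_eq_sym; apply: tens_eq_Z.
Qed.

Lemma tensE (t : tensor U V) : exists s : seq (U * V),
  t = \sum_(p <- s) p.1 ⊗ p.2.
Proof.
move: t; apply: tensorW => s; exists s; elim: s => [|[u v] s IH]; first by rewrite big_nil.
by rewrite big_cons -IH -[RHS]/(tensor_add _ _) tensor_addE.
Qed.

Lemma tensor_ind (P : tensor U V -> Prop) :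
    (forall s t, P s -> P t -> P (s + t)) -> (forall u v, P (u ⊗ v)) ->
  forall t, P t.
Proof.
move=> PD Pt t; have [s ->] := tensE t; apply: big_ind => //.
have [lin _] := tens_bilinear.
by have /= := lin 0 (-1) 0 0; rewrite scaler0 addr0 scaleN1r addNr => <-.
Qed.

Variables (W : lmodType R) (f : U -> V -> W).
Hypothesis f_bilinear : bilinear_map f.

Lemma tlift_pi s : tlift f (\pi_(tensor U V) s) = \sum_(p <- s) f p.1 p.2.
Proof.
case: f_bilinear => lin1 lin2.
have D1 u u' v : f (u + u') v = f u v + f u' v.
  by have /= := lin1 v 1 u u'; rewrite !scale1r.
have D2 u v v' : f u (v + v') = f u v + f u v'.
  by have /= := lin2 u 1 v v'; rewrite !scale1r.
have f0l v : f 0 v = 0.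
  by have /(congr1 (fun w => w - f 0 v)) := D1 0 0 v; rewrite addr0 addrK subrr.
have f0r u : f u 0 = 0.
  by have /(congr1 (fun w => w - f u 0)) := D2 u 0 0; rewrite addr0 addrK subrr.
have Z1 c u v : f (c *: u) v = c *: f u v.
  by have /= := lin1 v c u 0; rewrite f0l !addr0.
have Z2 c u v : f u (c *: v) = c *: f u v.
  by have /= := lin2 u c v 0; rewrite f0r !addr0.
rewrite /tlift; move: (tens_repr s); move: (repr _) => t; elim=> {s t} //=.
- by move=> s1 s2 r _ -> _ ->.
- by move=> s1 s2 s3 s4 _ e _ e'; rewrite !big_cat /= e e'.
- by move=> s1 s2; rewrite !big_cat /= addrC.
- by move=> v; rewrite big_seq1 big_nil /= f0l.
- by move=> u u' v; rewrite !big_cons !big_nil /= !addr0 D1.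
- by move=> u v v'; rewrite !big_cons !big_nil /= !addr0 D2.
- by move=> c u v; rewrite !big_seq1 /= Z1 Z2.
Qed.

Lemma tlift_tens u v : tlift f (u ⊗ v) = f u v.
Proof. by rewrite tlift_pi big_seq1. Qed.

Lemma tlift_linear : linear (tlift f).
Proof.
move=> c; apply: tensorW => s; apply: tensorW => t.
rewrite -[X in tlift f X]/(tensor_add (tensor_scale _ _) _).
rewrite tensor_scaleE tensor_addE !tlift_pi big_cat big_map /= scaler_sumr.
congr (_ + _); apply: eq_bigr => p _ /=.
have [lin1 _] := f_bilinear.
have f0l v : f 0 v = 0.
  have /(congr1 (fun w => w - f 0 v)) := lin1 v 1 0 0.
  by rewrite /= !scale1r addr0 addrK subrr.
by have /= := lin1 p.2 c p.1 0; rewrite f0l !addr0.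
Qed.

End TensorTheory.

Section TensorMaps.
Variable R : comNzRingType.

Definition tmap (U V U' V' : lmodType R) (f : U -> U') (g : V -> V')
    (t : tensor U V) : tensor U' V' :=
  \swd_(u, v <- t) f u ⊗ g v.

Definition tswap (U V : lmodType R) (t : tensor U V) : tensor V U :=
  \swd_(u, v <- t) v ⊗ u.

Definition tassoc (U V W : lmodType R) (t : tensor (tensor U V) W) :
    tensor U (tensor V W) :=
  \swd_(s, w <- t) \swd_(u, v <- s) u ⊗ (v ⊗ w).

Definition tmul (A B : algType R) (s t : tensor A B) : tensor A B :=
  \swd_(a, b <- s) \swd_(c, d <- t) (a * c) ⊗ (b * d).

End TensorMaps.

HB.mixin Record Lmodule_isCoalgebra (k : fieldType) C of GRing.Lmodule k C := {
  comul : {linear C -> tensor C C};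
  counit : {scalar C};
  comulA : forall c : C, tassoc (tmap comul id (comul c)) = tmap id comul (comul c);
  counitl : forall c : C, \swd_(c1, c2 <- comul c) counit c1 *: c2 = c;
  counitr : forall c : C, \swd_(c1, c2 <- comul c) counit c2 *: c1 = c
}.

#[short(type="coalgType")]
HB.structure Definition Coalgebra (k : fieldType) :=
  {C of Lmodule_isCoalgebra k C & GRing.Lmodule k C}.

HB.mixin Record Algebra_Coalgebra_isBialgebra (k : fieldType) B
    of GRing.Algebra k B & Coalgebra k B := {
  comul1 : comul (1 : B) = 1 ⊗ 1;
  comulM : forall a b : B, comul (a * b) = tmul (comul a) (comul b);
  counit1 : counit (1 : B) = 1;
  counitM : forall a b : B, counit (a * b) = counit a * counit b
}.

#[short(type="bialgType")]
HB.structure Definition Bialgebra (k : fieldType) :=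
  {B of Algebra_Coalgebra_isBialgebra k B & GRing.Algebra k B & Coalgebra k B}.

(** [algType] requires 1 != 0, which is no restriction here: the zero ring has
    no counit with counit 1 = 1. *)
HB.mixin Record Bialgebra_isHopf (k : fieldType) H of Bialgebra k H := {
  antipode : {linear H -> H};
  antipodel : forall a : H,
    \swd_(a1, a2 <- comul a) (antipode a1 * a2) = (counit a)%:A;
  antipoder : forall a : H,
    \swd_(a1, a2 <- comul a) (a1 * antipode a2) = (counit a)%:A
}.

#[short(type="hopfType")]
HB.structure Definition HopfAlgebra (k : fieldType) :=
  {H of Bialgebra_isHopf k H & Bialgebra k H}.

Definition cocommutative (k : fieldType) (C : coalgType k) : Prop :=
  forall c : C, tswap (comul c) = comul c.

Definition coalgebra_hom (k : fieldType) (C D : coalgType k) (f : C -> D) :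
    Prop :=
  [/\ linear f,
      forall c, comul (f c) = tmap f f (comul c)
    & forall c, counit (f c) = counit c].

Section ModuleBialgebra.
Variables (k : fieldType) (H K : hopfType k).
Implicit Types (act : H -> K -> K) (pi : H -> K).

(** [act], read as a map H -> End(K), is a homomorphism of k-algebras. *)
Definition algebra_action act : Prop :=
  [/\ bilinear_map act,
      forall x, act 1 x = x
    & forall a b x, act (a * b) x = act a (act b x)].

Definition module_algebra act : Prop :=
  [/\ algebra_action act,
      forall a, act a 1 = (counit a)%:A
    & forall a x y,
        act a (x * y) = \swd_(a1, a2 <- comul a) (act a1 x * act a2 y)].

Definition module_bialgebra act : Prop :=
  [/\ module_algebra act,
      forall a x, counit (act a x) = counit a * counit x
    & forall a x, comul (act a x) =
        \swd_(a1, a2 <- comul a) \swd_(x1, x2 <- comul x)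
          act a1 x1 ⊗ act a2 x2].

Definition crossed_hom act pi : Prop :=
  coalgebra_hom pi /\
  forall a b, pi (a * b) = \swd_(a1, a2 <- comul a) (pi a1 * act a2 (pi b)).

Definition adj (x y : K) : K :=
  \swd_(x1, x2 <- comul x) (x1 * y * antipode x2).

Definition derived_action act pi (a : H) (x : K) : K :=
  \swd_(a1, a2 <- comul a) adj (pi a1) (act a2 x).

End ModuleBialgebra.

(* Main.v *)
Require Import Defs.
From HB Require Import structures.
From mathcomp Require Import all_boot all_algebra.
From mathcomp Require Import boolp.
Import GRing.Theory.
Local Open Scope ring_scope.

(** Everything takes place in the algebra of linear maps from [H] to [K] under
    convolution, (f ∗ g)(a) = f(a_1) g(a_2), with unit a |-> ε(a)1.  The
    associativity of ∗ ([convA]) carries the repeated Sweedler sums.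

    Write q for the antipode of [K] composed with [pi], O_x for a |-> act a x
    and D_x for the derived action on x.  Since [pi] is a coalgebra map, q is
    the convolution inverse of [pi]; since [H] is cocommutative,
    D_x = pi ∗ O_x ∗ q ([derivedE]).  So D is O conjugated by [pi] in the
    convolution algebra, and D_(xy) = D_x ∗ D_y and D_1 = 1 follow at once from
    O_(xy) = O_x ∗ O_y and O_1 = 1.

    The other algebraic facts concern a product in [H].  In the first
    variable, the crossed homomorphism law reads pi(- b) = pi ∗ O_(pi b), and
    its companion for the inverse is q(- b) = O_(q b) ∗ q
    ([translate_antipode]): both sides of the latter are inverse to
    (a, b) |-> pi(a b) for convolution in two variables.  Hence
      D_x(- b) = pi ∗ O_(pi b_1) ∗ O_(act b_2 x) ∗ O_(q b_3) ∗ q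
               = pi ∗ O_(D_x(b)) ∗ q = D_(D_x(b)),
    which says that D is an action, and
      q ∗ D_(q b) = q ∗ pi ∗ O_(q b) ∗ q = O_(q b) ∗ q = q(- b),
    which is the crossed homomorphism law for q.

    For the coalgebra structure, write (f # g)(a) = f(a_1) ⊗ g(a_2).  When [H]
    is cocommutative, (f # f') ∗ (g # g') = (f ∗ g) # (f' ∗ g')
    ([tens_fun_conv]).  Therefore Δ ∘ q and q # q are both inverse to
    Δ ∘ pi = pi # pi and so are equal, and
      Δ ∘ D_x = (pi # pi) ∗ (O_(x_1) # O_(x_2)) ∗ (q # q) = D_(x_1) # D_(x_2). *)

Set Implicit Arguments.
Unset Strict Implicit.
Unset Printing Implicit Defensive.

(** * Linear maps and Sweedler sums *)

Lemma linear_bundle (R : comNzRingType) (U V : lmodType R) (f : U -> V) :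
  linear f -> exists g : {linear U -> V}, f = g.
Proof.
move=> f_lin; pose fL := GRing.isLinear.Build R U V *:%R f f_lin.
pose F : {linear U -> V} := HB.pack f fL.
by exists F.
Qed.

Section Linear.
Variables (R : comNzRingType) (U V W X : lmodType R).

Lemma linear_homogeneous (f : U -> V) (c : R) (x : U) :
  linear f -> f (c *: x) = c *: f x.
Proof.
by move=> f_lin; have [g ->] := linear_bundle f_lin; rewrite linearZ.
Qed.

Lemma linear_comp (f : V -> W) (g : U -> V) :
  linear f -> linear g -> linear (fun x => f (g x)).
Proof. by move=> f_lin g_lin c x y; rewrite g_lin f_lin. Qed.

(** For an arbitrary [f], [tlift f t] is a finite sum over a representative of
    [t], and [g] is additive; the same reason lets parameters and other Sweedler
    sums pass through. *)
Lemma linear_tlift (g : W -> X) (f : U -> V -> W) (t : tensor U V) :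
  linear g -> g (tlift f t) = \swd_(u, v <- t) g (f u v).
Proof.
by move=> g_lin; have [h ->] := linear_bundle g_lin; rewrite /tlift raddf_sum.
Qed.

Lemma eq_tlift (f g : U -> V -> W) (t : tensor U V) :
  (forall u v, f u v = g u v) -> tlift f t = tlift g t.
Proof. by move=> fg; apply: eq_bigr => p _. Qed.

Lemma tlift_linear_param (f : X -> U -> V -> W) (t : tensor U V) :
  (forall u v, linear (fun x => f x u v)) -> linear (fun x => tlift (f x) t).
Proof.
move=> f_lin c x y; rewrite /tlift scaler_sumr -big_split /=.
by apply: eq_bigr => p _; rewrite f_lin.
Qed.

Lemma bilinear_comp (X' : lmodType R)
    (f : V -> W -> X) (g : U -> V) (h : X' -> W) :
  bilinear_map f -> linear g -> linear h ->
  bilinear_map (fun x y => f (g x) (h y)).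
Proof.
case=> f1 f2 g_lin h_lin; split.
- by move=> y c x x' /=; rewrite g_lin; apply: f1.
- by move=> x c y y' /=; rewrite h_lin; apply: f2.
Qed.

End Linear.

Lemma tlift_exchange (R : comNzRingType) (U V U' V' W : lmodType R)
    (f : U -> V -> U' -> V' -> W) (s : tensor U V) (t : tensor U' V') :
  \swd_(u, v <- s) \swd_(x, y <- t) f u v x y
    = \swd_(x, y <- t) \swd_(u, v <- s) f u v x y.
Proof. exact: exchange_big. Qed.

Lemma tlift_comp (R : comNzRingType) (U V U' V' W : lmodType R)
    (f : U' -> V' -> W) (g : U -> V -> tensor U' V') (t : tensor U V) :
  bilinear_map f -> tlift f (tlift g t) = \swd_(u, v <- t) tlift f (g u v).
Proof. by move=> f_bil; apply: linear_tlift; apply: tlift_linear. Qed.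

Section Sweedler.
Variables (k : fieldType) (C : coalgType k) (W : lmodType k).

Lemma swd_coassoc (f : C -> C -> C -> W) :
    (forall y z, linear (fun x => f x y z)) ->
    (forall x z, linear (fun y => f x y z)) ->
    (forall x y, linear (fun z => f x y z)) ->
  forall c : C,
  \swd_(x, z <- comul c) \swd_(x1, x2 <- comul x) f x1 x2 z
    = \swd_(x, z <- comul c) \swd_(z1, z2 <- comul z) f x z1 z2.
Proof.
move=> f1 f2 f3 c.
have f23 x : bilinear_map (f x) by split=> [z|y]; [apply: f2 | apply: f3].
pose F (x : C) (t : tensor C C) := tlift (f x) t.
have F_bil : bilinear_map F.
  split=> [t|x]; last exact: tlift_linear.
  by apply: tlift_linear_param => y z; apply: f1.
have [tL tR] := @tens_bilinear k C C.
have [tL' tR'] := @tens_bilinear k C (tensor C C).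
have := congr1 (tlift F) (comulA c).
have in_bil (z : C) : bilinear_map (fun x y : C => x ⊗ (y ⊗ z)).
  split=> [y|x]; first exact: tL'.
  by apply: linear_comp; [apply: tR' | apply: tL].
have as_bil : bilinear_map
    (fun (s : tensor C C) (z : C) => \swd_(x, y <- s) x ⊗ (y ⊗ z)).
  split=> [z|s]; first exact: tlift_linear.
  apply: tlift_linear_param => x y.
  by apply: linear_comp; [apply: tR' | apply: tR].
rewrite /tassoc /tmap !tlift_comp //.
under [LHS]eq_tlift => u v.
  rewrite tlift_tens // tlift_comp //.
  under eq_tlift => x y do rewrite tlift_tens //=.
  over.
under [RHS]eq_tlift => u v do rewrite tlift_tens //=.
rewrite /F => E.
transitivity
  (\swd_(u, v <- comul c) \swd_(x, y <- comul u) tlift (f x) (y ⊗ v)).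
  by apply: eq_tlift => u v; apply: eq_tlift => x y; rewrite tlift_tens.
by rewrite E.
Qed.

Lemma swd_counitl (f : C -> W) (c : C) : linear f ->
  \swd_(x, y <- comul c) counit x *: f y = f c.
Proof.
move=> f_lin; rewrite -[in RHS](counitl c) (linear_tlift _ _ f_lin).
by apply: eq_tlift => x y; rewrite linear_homogeneous.
Qed.

Lemma swd_counitr (f : C -> W) (c : C) : linear f ->
  \swd_(x, y <- comul c) counit y *: f x = f c.
Proof.
move=> f_lin; rewrite -[in RHS](counitr c) (linear_tlift _ _ f_lin).
by apply: eq_tlift => x y; rewrite linear_homogeneous.
Qed.

Lemma swd_cocomm (f : C -> C -> W) (c : C) :
  cocommutative C -> bilinear_map f ->
  \swd_(x, y <- comul c) f x y = \swd_(x, y <- comul c) f y x.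
Proof.
move=> C_cocomm f_bil; rewrite -{1}(C_cocomm c) /tswap tlift_comp //.
by apply: eq_tlift => x y; rewrite tlift_tens.
Qed.

Lemma swd_coalgebra_hom (D : coalgType k) (p : C -> D) (f : D -> D -> W)
    (c : C) :
  coalgebra_hom p -> bilinear_map f ->
  \swd_(x, y <- comul (p c)) f x y = \swd_(x, y <- comul c) f (p x) (p y).
Proof.
case=> _ -> _ f_bil; rewrite /tmap tlift_comp //.
by apply: eq_tlift => x y; rewrite tlift_tens.
Qed.

End Sweedler.

(** * Algebras given by their multiplication *)

(** Associative unital algebras as unbundled data, so that convolution applies
    alike to an [algType] and to a tensor product of two of them, which is not
    made an [algType] instance. *)
Definition is_algebra (R : comNzRingType) (A : lmodType R)
    (m : A -> A -> A) (e : A) : Prop :=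
  [/\ bilinear_map m, associative m, left_id e m & right_id e m].

Lemma mul_is_algebra (R : comNzRingType) (A : algType R) :
  is_algebra ( *%R : A -> A -> A) 1.
Proof.
split; [|exact: mulrA|exact: mul1r|exact: mulr1].
split=> [y c x x'|x c y y'] /=; first by rewrite mulrDl scalerAl.
by rewrite mulrDr scalerAr.
Qed.

Section TensorAlgebra.
Variables (R : comNzRingType) (A B : algType R).

Lemma tmul_tens_bilinear (a : A) (b : B) :
  bilinear_map (fun c d => (a * c) ⊗ (b * d)).
Proof.
have [[_ mA] _ _ _] := mul_is_algebra A.
have [[_ mB] _ _ _] := mul_is_algebra B.
by apply: bilinear_comp; [apply: tens_bilinear | apply: mA | apply: mB].
Qed.

Lemma tmul_tens_bilinearl (t : tensor A B) :
  bilinear_map (fun a b => \swd_(c, d <- t) (a * c) ⊗ (b * d)).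
Proof.
have [[mA _] _ _ _] := mul_is_algebra A.
have [[mB _] _ _ _] := mul_is_algebra B.
have [tL tR] := @tens_bilinear R A B.
split=> [b|a]; apply: tlift_linear_param => c d.
- by apply: (linear_comp (tL _)); apply: mA.
- by apply: (linear_comp (tR _)); apply: mB.
Qed.

Lemma tmul_bilinear : bilinear_map (@tmul R A B).
Proof.
split=> [t|s]; last first.
  apply: tlift_linear_param => a b; apply: tlift_linear.
  exact: tmul_tens_bilinear.
exact/tlift_linear/tmul_tens_bilinearl.
Qed.

Lemma tmul_tens (a c : A) (b d : B) :
  tmul (a ⊗ b) (c ⊗ d) = (a * c) ⊗ (b * d).
Proof.
rewrite /tmul !tlift_tens //; first exact: tmul_tens_bilinear.
exact: tmul_tens_bilinearl.
Qed.

Lemma tmul_is_algebra : is_algebra (@tmul R A B) (1 ⊗ 1).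
Proof.
have [lL lR] := tmul_bilinear.
have DL s s' t : tmul (s + s') t = tmul s t + tmul s' t :> tensor A B.
  by have := lL t 1 s s'; rewrite /= !scale1r.
have DR s t t' : tmul s (t + t') = tmul s t + tmul s t' :> tensor A B.
  by have := lR s 1 t t'; rewrite /= !scale1r.
split; first exact: tmul_bilinear.
- elim/tensor_ind => [s s' IH IH' t r|a b]; first by rewrite !DL IH IH'.
  elim/tensor_ind => [t t' IH IH' r|c d]; first by rewrite !(DL, DR) IH IH'.
  elim/tensor_ind => [r r' IH IH'|x y]; first by rewrite !DR IH IH'.
  by rewrite !tmul_tens !mulrA.
- elim/tensor_ind => [s s' IH IH'|a b]; first by rewrite DR IH IH'.
  by rewrite tmul_tens !mul1r.
- elim/tensor_ind => [s s' IH IH'|a b]; first by rewrite DL IH IH'.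
  by rewrite tmul_tens !mulr1.
Qed.

End TensorAlgebra.

(** * Convolution *)

Section Convolution.
Variables (k : fieldType) (C : coalgType k) (A : lmodType k).
Variables (m : A -> A -> A) (e : A).
Hypothesis A_alg : is_algebra m e.
Implicit Types f g h : C -> A.

Definition conv f g (c : C) : A := \swd_(x, y <- comul c) m (f x) (g y).

Definition conv_unit (c : C) : A := counit c *: e.

Let mulB : bilinear_map m. Proof. by case: A_alg. Qed.
Let mA : associative m. Proof. by case: A_alg. Qed.
Let m1l : left_id e m. Proof. by case: A_alg. Qed.
Let m1r : right_id e m. Proof. by case: A_alg. Qed.
Let mLl y : linear (fun x => m x y). Proof. by case: mulB. Qed.
Let mLr x : linear (m x). Proof. by case: mulB. Qed.
Let mZl c x y : m (c *: x) y = c *: m x y.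
Proof. exact: (linear_homogeneous c x (mLl y)). Qed.
Let mZr c x y : m x (c *: y) = c *: m x y.
Proof. exact: (linear_homogeneous c y (mLr x)). Qed.

Lemma conv_bilinear f g :
  linear f -> linear g -> bilinear_map (fun x y => m (f x) (g y)).
Proof. exact: bilinear_comp. Qed.

Lemma conv_linear f g : linear f -> linear g -> linear (conv f g).
Proof.
move=> f_lin g_lin; apply: linear_comp; last exact: linearP.
exact/tlift_linear/conv_bilinear.
Qed.

Lemma conv_unit_linear : linear conv_unit.
Proof. by move=> c x y; rewrite /conv_unit linearP scalerDl scalerA. Qed.

Lemma convA f g h : linear f -> linear g -> linear h ->
  conv f (conv g h) = conv (conv f g) h.
Proof.
move=> f_lin g_lin h_lin; apply: funext => c; rewrite /conv.
under eq_tlift => x z do rewrite (linear_tlift _ _ (@mLr _)).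
under [RHS]eq_tlift => x z do rewrite (linear_tlift _ _ (@mLl _)).
rewrite swd_coassoc /=.
- by apply: eq_tlift => x z; apply: eq_tlift => z1 z2; rewrite mA.
- by move=> y z d u v; rewrite f_lin !mLl.
- by move=> x z d u v; rewrite g_lin mLr mLl.
- by move=> x y d u v; rewrite h_lin mLr.
Qed.

Lemma conv1l f : linear f -> conv conv_unit f = f.
Proof.
move=> f_lin; apply: funext => c; rewrite -[RHS](swd_counitl _ f_lin).
by apply: eq_tlift => x y; rewrite mZl m1l.
Qed.

Lemma conv1r f : linear f -> conv f conv_unit = f.
Proof.
move=> f_lin; apply: funext => c; rewrite -[RHS](swd_counitr _ f_lin).
by apply: eq_tlift => x y; rewrite mZr m1r.
Qed.

Lemma conv_inv_unique f g h : linear f -> linear g -> linear h ->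
  conv f g = conv_unit -> conv g h = conv_unit -> f = h.
Proof.
move=> f_lin g_lin h_lin fg gh.
by rewrite -(conv1r f_lin) -gh convA // fg conv1l.
Qed.

(** Values that commute make the maps commute only up to exchanging the two
    legs of the coproduct, hence cocommutativity. *)
Lemma conv_commute f g :
  cocommutative C -> linear f -> linear g ->
  (forall x y, m (f x) (g y) = m (g y) (f x)) -> conv f g = conv g f.
Proof.
move=> C_cocomm f_lin g_lin fg; apply: funext => c.
rewrite /conv swd_cocomm //; last exact: conv_bilinear.
by apply: eq_tlift => x y; apply: fg.
Qed.

Lemma conv_tlift_l (U V : lmodType k) (f : U -> V -> C -> A)
    (t : tensor U V) g c :
  conv (fun x => \swd_(u, v <- t) f u v x) g c
    = \swd_(u, v <- t) conv (f u v) g c.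
Proof.
rewrite /conv tlift_exchange; apply: eq_tlift => x y.
by rewrite (linear_tlift _ _ (@mLl _)).
Qed.

Lemma conv_tlift_r (U V : lmodType k) f (g : U -> V -> C -> A)
    (t : tensor U V) c :
  conv f (fun x => \swd_(u, v <- t) g u v x) c
    = \swd_(u, v <- t) conv f (g u v) c.
Proof.
rewrite /conv tlift_exchange; apply: eq_tlift => x y.
by rewrite (linear_tlift _ _ (@mLr _)).
Qed.

Lemma conv_scale_l d f g c : conv (fun x => d *: f x) g c = d *: conv f g c.
Proof. by rewrite /conv /tlift scaler_sumr; apply: eq_bigr => p _. Qed.

Lemma conv_scale_r d f g c : conv f (fun x => d *: g x) c = d *: conv f g c.
Proof. by rewrite /conv /tlift scaler_sumr; apply: eq_bigr => p _. Qed.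

Lemma conv_param_l (X : lmodType k) (f : X -> C -> A) g c :
  (forall a, linear (fun x => f x a)) -> linear (fun x => conv (f x) g c).
Proof.
move=> f_lin; apply: tlift_linear_param => a b.
exact: linear_comp (mLl _) (f_lin a).
Qed.

Lemma conv_param_r (X : lmodType k) f (g : X -> C -> A) c :
  (forall a, linear (fun x => g x a)) -> linear (fun x => conv f (g x) c).
Proof.
move=> g_lin; apply: tlift_linear_param => a b.
exact: linear_comp (mLr _) (g_lin b).
Qed.

End Convolution.

Lemma comp_conv (k : fieldType) (C : coalgType k) (A B : lmodType k)
    (m : A -> A -> A) (m' : B -> B -> B) (p : A -> B) (f g : C -> A) c :
  linear p -> (forall x y, p (m x y) = m' (p x) (p y)) ->
  p (conv m f g c) = conv m' (p \o f) (p \o g) c.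
Proof.
by move=> p_lin pM; rewrite /conv (linear_tlift _ _ p_lin); apply: eq_tlift.
Qed.

Lemma conv_at1 (k : fieldType) (H : bialgType k) (A : lmodType k)
    (m : A -> A -> A) (f g : H -> A) :
  bilinear_map m -> linear f -> linear g -> conv m f g 1 = m (f 1) (g 1).
Proof.
move=> m_bil f_lin g_lin; rewrite /conv comul1 tlift_tens //.
exact: bilinear_comp.
Qed.

(** For a fixed right factor [b], multiplicativity of the coproduct turns
    convolution at [a * b] into convolution in [a] summed over the coproduct of
    [b]; this reduces convolution in two variables to convolution in one. *)
Lemma conv_mulr (k : fieldType) (H : bialgType k) (A : lmodType k)
    (m : A -> A -> A) (f g : H -> A) (a b : H) :
  bilinear_map m -> linear f -> linear g ->
  conv m f g (a * b) = \swd_(b1, b2 <- comul b)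
    conv m (fun x => f (x * b1)) (fun x => g (x * b2)) a.
Proof.
move=> m_bil f_lin g_lin; have fg_bil := bilinear_comp m_bil f_lin g_lin.
rewrite /conv comulM /tmul tlift_comp //.
under eq_tlift => a1 a2 do
  (rewrite tlift_comp //; under eq_tlift => b1 b2 do rewrite tlift_tens //).
exact: tlift_exchange.
Qed.

(** * Convolution into a tensor product *)

Section MiddleFour.
Variables (k : fieldType) (C : coalgType k) (A B : algType k).
Hypothesis C_cocomm : cocommutative C.

Local Notation conv_A := (conv (@GRing.mul A)).
Local Notation conv_B := (conv (@GRing.mul B)).
Local Notation conv_T := (conv (@tmul k A B)).

Definition inl_fun (f : C -> A) (c : C) : tensor A B := f c ⊗ 1.
Definition inr_fun (g : C -> B) (c : C) : tensor A B := 1 ⊗ g c.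

Lemma inl_fun_linear f : linear f -> linear (inl_fun f).
Proof.
have [tL _] := @tens_bilinear k A B.
by move=> f_lin; apply: linear_comp (tL 1) f_lin.
Qed.

Lemma inr_fun_linear g : linear g -> linear (inr_fun g).
Proof.
have [_ tR] := @tens_bilinear k A B.
by move=> g_lin; apply: linear_comp (tR 1) g_lin.
Qed.

Lemma inl_fun_conv f g : inl_fun (conv_A f g) = conv_T (inl_fun f) (inl_fun g).
Proof.
have [tL _] := @tens_bilinear k A B.
apply: funext => c; apply: (comp_conv _ _ _ (tL 1)) => x y.
by rewrite tmul_tens mulr1.
Qed.

Lemma inr_fun_conv f g : inr_fun (conv_B f g) = conv_T (inr_fun f) (inr_fun g).
Proof.
have [_ tR] := @tens_bilinear k A B.
apply: funext => c; apply: (comp_conv _ _ _ (tR 1)) => x y.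
by rewrite tmul_tens mulr1.
Qed.

Definition tens_fun (f : C -> A) (g : C -> B) (c : C) : tensor A B :=
  tmap f g (comul c).

Lemma tens_funE f g : tens_fun f g = conv_T (inl_fun f) (inr_fun g).
Proof.
apply: funext => c; apply: eq_tlift => x y.
by rewrite tmul_tens mulr1 mul1r.
Qed.

Lemma tens_fun_linear f g : linear f -> linear g -> linear (tens_fun f g).
Proof.
move=> f_lin g_lin; rewrite tens_funE.
apply: (conv_linear (tmul_is_algebra A B)).
- exact: inl_fun_linear.
- exact: inr_fun_linear.
Qed.

(** The middle-four interchange.  As [tens_fun f g] is the convolution of
    [inl_fun f] and [inr_fun g], only the two inner factors have to be
    exchanged; their values lie in different tensor factors and so commute. *)
Lemma tens_fun_conv f1 g1 f2 g2 :
  linear f1 -> linear g1 -> linear f2 -> linear g2 ->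
  tens_fun (conv_A f1 g1) (conv_B f2 g2)
    = conv_T (tens_fun f1 f2) (tens_fun g1 g2).
Proof.
move=> /inl_fun_linear f1L /inl_fun_linear g1L /inr_fun_linear f2L.
move=> /inr_fun_linear g2L.
have T_alg := tmul_is_algebra A B; have cL := conv_linear T_alg.
rewrite !tens_funE inl_fun_conv inr_fun_conv.
rewrite -!(convA T_alg); do ?[by []|exact: cL].
congr (conv_T _ _); rewrite !(convA T_alg) //; congr (conv_T _ _).
apply: (conv_commute T_alg) => // x y.
by rewrite !tmul_tens !mulr1 !mul1r.
Qed.

Lemma tens_fun_unit :
  tens_fun (conv_unit 1) (conv_unit 1) = conv_unit (1 ⊗ 1).
Proof.
have [tL tR] := @tens_bilinear k A B.
apply: funext => c; rewrite -(swd_counitl c (conv_unit_linear _)).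
apply: eq_tlift => x y; rewrite /conv_unit (linear_homogeneous _ _ (tL _)).
by rewrite (linear_homogeneous _ _ (tR _)).
Qed.

End MiddleFour.

(** * Bialgebras and Hopf algebras *)

Lemma counit_conv (k : fieldType) (C : coalgType k) (B : bialgType k)
    (f g : C -> B) (s t : k) (c : C) :
  (forall x, counit (f x) = counit x * s) ->
  (forall x, counit (g x) = counit x * t) ->
  counit (conv *%R f g c) = counit c * (s * t).
Proof.
move=> f_counit g_counit; rewrite -[in RHS](counitl c) /conv /tlift.
rewrite !raddf_sum /= mulr_suml; apply: eq_bigr => p _.
by rewrite scalarZ /= counitM f_counit g_counit mulrACA.
Qed.

Lemma comul_conv (k : fieldType) (C : coalgType k) (B : bialgType k)
    (f g : C -> B) :
  (fun c => comul (conv *%R f g c))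
    = conv (@tmul k B B) (fun c => comul (f c)) (fun c => comul (g c)).
Proof.
apply: funext => c; apply: (comp_conv _ _ _ (linearP _)); exact: comulM.
Qed.

Lemma antipode_mul_bilinear (k : fieldType) (K : hopfType k) :
  bilinear_map (fun x y : K => antipode x * y).
Proof.
have [m_bil _ _ _] := mul_is_algebra K.
by apply: bilinear_comp m_bil _ _ => //; apply: linearP.
Qed.

Lemma mul_antipode_bilinear (k : fieldType) (K : hopfType k) :
  bilinear_map (fun x y : K => x * antipode y).
Proof.
have [m_bil _ _ _] := mul_is_algebra K.
by apply: bilinear_comp m_bil _ _ => //; apply: linearP.
Qed.

Lemma antipode1 (k : fieldType) (K : hopfType k) : antipode (1 : K) = 1.
Proof.
have := antipodel (1 : K); rewrite comul1 tlift_tens.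
  by rewrite mulr1 counit1 scale1r.
exact: antipode_mul_bilinear.
Qed.

(** * The derived action *)

Section Derived.
Variables (k : fieldType) (H K : hopfType k).
Hypothesis H_cocomm : cocommutative H.
Variables (act : H -> K -> K) (pi : H -> K).
Hypotheses (K_module : module_bialgebra act) (pi_crossed : crossed_hom act pi).

Local Notation "f ∗ g" := (conv (@GRing.mul K) f g)
  (at level 40, left associativity).
Local Notation unit_fun := (@conv_unit k H K 1).
Local Notation translate b f := (fun a => f (a * b)).
Local Notation orb x := (fun a => act a x).
Local Notation q := (fun a => antipode (pi a)).
Local Notation D x := (fun a => derived_action act pi a x).

Let K_alg := mul_is_algebra K.

Let mul_bil : bilinear_map ( *%R : K -> K -> K). Proof. by case: K_alg. Qed.
Let act_linl x : linear (orb x).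
Proof. by case: K_module => [[[[h _] _ _] _ _] _ _]; apply: h. Qed.
Let act_linr a : linear (act a).
Proof. by case: K_module => [[[[_ h] _ _] _ _] _ _]; apply: h. Qed.
Let act1 x : act 1 x = x.
Proof. by case: K_module => [[[_ h _] _ _] _ _]. Qed.
Let actM a b x : act (a * b) x = act a (act b x).
Proof. by case: K_module => [[[_ _ h] _ _] _ _]. Qed.
Let pi_hom : coalgebra_hom pi. Proof. by case: pi_crossed. Qed.
Let pi_lin : linear pi. Proof. by case: pi_hom. Qed.
Let q_lin : linear q.
Proof. by move=> c a b; rewrite pi_lin linearP. Qed.
Let conv_lin (f g : H -> K) : linear f -> linear g -> linear (f ∗ g).
Proof. exact: conv_linear K_alg _ _. Qed.
Let unit_lin : linear unit_fun. Proof. exact: conv_unit_linear. Qed.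

Hint Resolve act_linl act_linr pi_lin q_lin unit_lin : core.
Hint Extern 1 (GRing.linear_for _ (conv _ _ _)) => apply: conv_lin : core.

Lemma orbit1 : orb 1 = unit_fun.
Proof. by case: K_module => [[_ h _] _ _]; apply: funext => a; rewrite h. Qed.

Lemma orbitM x y : orb (x * y) = orb x ∗ orb y.
Proof. by case: K_module => [[_ _ h] _ _]; apply: funext => a; rewrite h. Qed.

Lemma conv_pi_antipode : pi ∗ q = unit_fun.
Proof.
apply: funext => a; have [_ _ pi_counit] := pi_hom.
rewrite /conv -(swd_coalgebra_hom _ pi_hom (@mul_antipode_bilinear _ K)).
by rewrite antipoder pi_counit.
Qed.

Lemma conv_antipode_pi : q ∗ pi = unit_fun.
Proof.
apply: funext => a; have [_ _ pi_counit] := pi_hom.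
rewrite /conv -(swd_coalgebra_hom _ pi_hom (@antipode_mul_bilinear _ K)).
by rewrite antipodel pi_counit.
Qed.

(** The definition yields pi(a_1) (act a_3 x) q(a_2); cocommutativity exchanges
    the last two legs. *)
Lemma derivedE x : D x = pi ∗ (orb x ∗ q).
Proof.
apply: funext => a; rewrite /derived_action /adj.
have a_lin : linear (antipode : K -> K) by exact: linearP.
have [mL mR] := mul_bil.
have -> : \swd_(a1, a2 <- comul a)
    (\swd_(x1, x2 <- comul (pi a1)) (x1 * act a2 x * antipode x2)) =
    \swd_(a1, a2 <- comul a) \swd_(b1, b2 <- comul a1)
       (pi b1 * act a2 x * antipode (pi b2)).
  apply: eq_tlift => a1 a2; rewrite (swd_coalgebra_hom _ pi_hom) //.
  apply: (bilinear_comp mul_bil _ a_lin); exact: mL.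
rewrite swd_coassoc.
- apply: eq_tlift => a1 a2; rewrite /conv (linear_tlift _ _ (mR _)).
  rewrite swd_cocomm //; last first.
    split=> [z|y].
      by apply: (linear_comp (mR _) q_lin).
    by move=> c u v; rewrite act_linl mR mL.
  by apply: eq_tlift => u v; rewrite mulrA.
- by move=> y z c u v; rewrite pi_lin !mL.
- by move=> x' z; apply: (linear_comp (mR _) q_lin).
- by move=> x' y c u v; rewrite act_linl mR mL.
Qed.

Let D_linl x : linear (D x).
Proof. by rewrite derivedE; auto. Qed.

Let D_linr a : linear (derived_action act pi a).
Proof.
have -> : derived_action act pi a = fun x => (pi ∗ (orb x ∗ q)) a.
  by apply: funext => x; rewrite -derivedE.
by apply: (conv_param_r K_alg) => b; apply: (conv_param_l K_alg) => c.
Qed.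

Lemma derived_unit : D 1 = unit_fun.
Proof. by rewrite derivedE orbit1 conv1l // conv_pi_antipode. Qed.

Lemma derivedM x y : D (x * y) = D x ∗ D y.
Proof.
rewrite !derivedE orbitM -!(convA K_alg); auto.
congr (_ ∗ (_ ∗ _)).
by rewrite (convA K_alg q_lin) ?conv_antipode_pi ?conv1l; auto.
Qed.

(** [pi 1] is idempotent by the crossed homomorphism law, and invertible, since
    it is group-like. *)
Lemma crossed_hom1 : pi 1 = 1.
Proof.
have [_ pi_comul pi_counit] := pi_hom.
have S_bil := @antipode_mul_bilinear _ K.
have p_bil : bilinear_map (fun a b => pi a ⊗ pi b).
  exact: bilinear_comp (@tens_bilinear _ _ _) pi_lin pi_lin.
have idem : pi 1 * pi 1 = pi 1.
  have [_ /(_ 1 1)] := pi_crossed; rewrite mulr1 => {3}->.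
  rewrite comul1 tlift_tens ?act1 //.
  exact: bilinear_comp mul_bil pi_lin (act_linl _).
have Sp : antipode (pi 1) * pi 1 = 1.
  have := antipodel (pi 1).
  by rewrite pi_comul comul1 /tmap !tlift_tens // pi_counit counit1 scale1r.
by rewrite -[LHS]mul1r -Sp -mulrA idem Sp.
Qed.

Lemma derived_act1 x : derived_action act pi 1 x = x.
Proof.
rewrite -[LHS]/(D x 1) derivedE !conv_at1; auto.
by rewrite crossed_hom1 antipode1 act1 mul1r mulr1.
Qed.

Lemma translate_pi b : translate b pi = pi ∗ orb (pi b).
Proof. by have [_ h] := pi_crossed; apply: funext => a; rewrite h. Qed.

Lemma translate_lin b (f : H -> K) : linear f -> linear (translate b f).
Proof.
move=> f_lin; have [[hL _] _ _ _] := mul_is_algebra H.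
exact: linear_comp f_lin (hL b).
Qed.
Hint Resolve translate_lin : core.

Lemma translate_pi_conv b x : translate b pi ∗ (orb x ∗ q) = D (pi b * x).
Proof. by rewrite derivedE orbitM translate_pi !(convA K_alg); auto. Qed.

(** Half of the two-variable inverse argument: the map
    (a, b) |-> (act a_1 (q b)) q(a_2) is a right inverse of (a, b) |-> pi(a b),
    because the sum collapses to the derived action on (pi ∗ q)(b). *)
Lemma translate_pi_inverse a b :
  \swd_(b1, b2 <- comul b) (translate b1 pi ∗ (orb (q b2) ∗ q)) a
    = counit b *: unit_fun a.
Proof.
under eq_tlift => b1 b2 do rewrite translate_pi_conv.
rewrite -(linear_tlift _ _ (D_linr a)) -[tlift _ _]/((pi ∗ q) b).
rewrite conv_pi_antipode (linear_homogeneous _ _ (D_linr a)).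
by rewrite -[derived_action _ _ _ _]/(D 1 a) derived_unit.
Qed.

(** A left inverse of (a, b) |-> pi(a b) equals a right inverse; the left
    inverse is (a, b) |-> q(a b), as q is inverse to [pi]. *)
Lemma translate_antipode b : translate b q = orb (q b) ∗ q.
Proof.
have [[_ hL] _ _ _] := mul_is_algebra H.
apply: funext => a.
have Rq_lin c : linear (fun x => q (c * x)).
  exact: linear_comp q_lin (hL c).
have Rpi_lin c : linear (fun x => pi (c * x)).
  exact: linear_comp pi_lin (hL c).
have Mq_lin c : linear (fun x => (orb (q x) ∗ q) c).
  by apply: (conv_param_l K_alg) => d; apply: linear_comp (act_linr d) q_lin.
(* The usual sandwich left ∗ middle ∗ right, bracketed to the right here and
   to the left after coassociativity in the variable b. *)
transitivity (\swd_(b1, b2 <- comul b) \swd_(c1, c2 <- comul b2)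
    (translate b1 q ∗ (translate c1 pi ∗ (orb (q c2) ∗ q))) a).
  rewrite -[LHS](swd_counitr b (Rq_lin a)); apply: eq_tlift => b1 b2.
  rewrite -(conv_tlift_r K_alg).
  have -> : (fun x => \swd_(c1, c2 <- comul b2)
      (translate c1 pi ∗ (orb (q c2) ∗ q)) x)
      = fun x => counit b2 *: unit_fun x.
    by apply: funext => x; exact: (translate_pi_inverse x b2).
  by rewrite (conv_scale_r K_alg) (conv1r K_alg (translate_lin b1 q_lin)).
rewrite -(swd_coassoc (f := fun x y z =>
  (translate x q ∗ (translate y pi ∗ (orb (q z) ∗ q))) a)).
- rewrite -[RHS](swd_counitl b (Mq_lin a)); apply: eq_tlift => b1 b2.
  under eq_tlift => c1 c2 do rewrite (convA K_alg (translate_lin c1 q_lin)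
    (translate_lin c2 pi_lin) (conv_lin (act_linl _) q_lin)).
  rewrite -(conv_tlift_l K_alg).
  have -> : (fun x =>
      \swd_(u, v <- comul b1) (translate u q ∗ translate v pi) x)
      = fun x => counit b1 *: unit_fun x.
    apply: funext => x; rewrite -[LHS](conv_mulr x b1 mul_bil q_lin pi_lin).
    by rewrite conv_antipode_pi /conv_unit counitM mulrC scalerA.
  by rewrite (conv_scale_l K_alg) conv1l //; auto.
- move=> y z; apply: (conv_param_l K_alg) => c; exact: Rq_lin.
- move=> x z; apply: (conv_param_r K_alg) => c.
  apply: (conv_param_l K_alg) => d; exact: Rpi_lin.
- move=> x y; apply: (conv_param_r K_alg) => c.
  apply: (conv_param_r K_alg) => d; exact: Mq_lin.
Qed.

Lemma derived_actM a b x :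
  derived_action act pi (a * b) x
    = derived_action act pi a (derived_action act pi b x).
Proof.
rewrite -[LHS]/(D x (a * b)) derivedE conv_mulr; auto.
rewrite -[derived_action act pi b x]/(D x b) derivedE.
rewrite [in RHS]/conv (linear_tlift _ _ (D_linr a)); apply: eq_tlift => b1 b2.
have [_ mR] := mul_bil.
rewrite (linear_tlift _ _ (mR _)) (linear_tlift _ _ (D_linr a)).
have -> : translate b2 (orb x ∗ q) = fun c => \swd_(c1, c2 <- comul b2)
    (orb (act c1 x * q c2) ∗ q) c.
  apply: funext => c; rewrite conv_mulr; auto; apply: eq_tlift => c1 c2.
  rewrite translate_antipode orbitM -(convA K_alg); auto.
  by congr (conv _ _ _ c); apply: funext => y; rewrite actM.
rewrite (conv_tlift_r K_alg); apply: eq_tlift => c1 c2.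
by rewrite translate_pi_conv.
Qed.

(** The counit applied to q ∗ pi = 1, where [pi] preserves the counit. *)
Lemma antipode_counit a : counit (antipode (pi a)) = counit a.
Proof.
have [_ _ pi_counit] := pi_hom.
have := congr1 (fun f => counit (f a)) conv_antipode_pi.
rewrite /= /conv_unit scalarZ /= counit1 mulr1 => <-.
rewrite -[in LHS](swd_counitr a q_lin) /conv /tlift !raddf_sum /=.
by apply: eq_bigr => p _; rewrite scalarZ counitM pi_counit mulrC.
Qed.

Lemma derived_counit a x :
  counit (derived_action act pi a x) = counit a * counit x.
Proof.
have [_ _ pi_counit] := pi_hom; have [_ act_counit _] := K_module.
rewrite -[derived_action _ _ _ _]/(D x a) derivedE.
rewrite (counit_conv _ (s := 1) (t := counit x)) ?mul1r // => b.
  by rewrite pi_counit mulr1.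
by rewrite (counit_conv _ (s := counit x) (t := 1)) ?mulr1 // => c;
  rewrite antipode_counit mulr1.
Qed.

Local Notation "f ⊛ g" := (conv (@tmul k K K) f g)
  (at level 40, left associativity).

Let KK_alg := tmul_is_algebra K K.

Lemma comul_pi : (fun a => comul (pi a)) = tens_fun pi pi.
Proof. by have [_ h _] := pi_hom; apply: funext. Qed.

(** Both sides are convolution inverses of the coproduct of [pi] in the maps
    from [H] to the tensor square of [K]. *)
Lemma comul_antipode_pi : (fun a => comul (q a)) = tens_fun q q.
Proof.
have unitE :
    tens_fun unit_fun unit_fun = conv_unit (1 ⊗ 1) :> (H -> tensor K K).
  exact: tens_fun_unit.
apply: (conv_inv_unique KK_alg (g := tens_fun pi pi)).
- by move=> c x y; rewrite q_lin linearP.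
- exact: tens_fun_linear.
- exact: tens_fun_linear.
- rewrite -comul_pi -comul_conv conv_antipode_pi; apply: funext => a.
  by rewrite /conv_unit linearZ /= comul1.
- by rewrite -tens_fun_conv // conv_pi_antipode.
Qed.

Lemma comul_orb x :
  (fun a => comul (act a x)) =
    fun a => \swd_(x1, x2 <- comul x) tens_fun (orb x1) (orb x2) a.
Proof.
have [_ _ h] := K_module; apply: funext => a; rewrite h tlift_exchange.
by [].
Qed.

Lemma derived_comul a x : comul (derived_action act pi a x) =
  \swd_(a1, a2 <- comul a) \swd_(x1, x2 <- comul x)
    derived_action act pi a1 x1 ⊗ derived_action act pi a2 x2.
Proof.
transitivity (\swd_(x1, x2 <- comul x) tens_fun (D x1) (D x2) a); last first.
  exact: tlift_exchange.
rewrite -[derived_action _ _ _ _]/(D x a) derivedE.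
rewrite -[LHS]/((fun c => comul ((pi ∗ (orb x ∗ q)) c)) a).
rewrite comul_conv comul_conv comul_pi comul_antipode_pi comul_orb.
have -> : (fun c => \swd_(x1, x2 <- comul x) tens_fun (orb x1) (orb x2) c)
    ⊛ tens_fun q q
  = fun c => \swd_(x1, x2 <- comul x)
      (tens_fun (orb x1) (orb x2) ⊛ tens_fun q q) c.
  by apply: funext => c; apply: (conv_tlift_l KK_alg).
rewrite (conv_tlift_r KK_alg); apply: eq_tlift => x1 x2.
by rewrite !derivedE !tens_fun_conv; auto.
Qed.

Lemma derived_module_bialgebra : module_bialgebra (derived_action act pi).
Proof.
split; [split; [split|..]|..].
- by split=> [x|a]; [apply: D_linl | apply: D_linr].
- exact: derived_act1.
- exact: derived_actM.
- by move=> a; rewrite -[LHS]/(D 1 a) derived_unit.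
- by move=> a x y; rewrite -[LHS]/(D (x * y) a) derivedM.
- exact: derived_counit.
- exact: derived_comul.
Qed.

Lemma derived_crossed_hom :
  crossed_hom (derived_action act pi) (antipode \o pi).
Proof.
split; first split.
- exact: q_lin.
- by move=> a; rewrite -[LHS]/((fun a => comul (q a)) a) comul_antipode_pi.
- exact: antipode_counit.
move=> a b; rewrite -[LHS]/(translate b q a) translate_antipode.
rewrite -[RHS]/((q ∗ D (q b)) a) derivedE (convA K_alg); auto.
by rewrite conv_antipode_pi conv1l; auto.
Qed.

End Derived.

Theorem theorem4p5 (k : fieldType) (k_char0 : [pchar k] =i pred0)
    (H K : hopfType k) (H_cocomm : cocommutative H)
    (act : H -> K -> K) (K_module : module_bialgebra act)
    (pi : H -> K) (pi_crossed : crossed_hom act pi) :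
  module_bialgebra (derived_action act pi) /\
  crossed_hom (derived_action act pi) (antipode \o pi).
Proof.
by split; [apply: derived_module_bialgebra | apply: derived_crossed_hom].
Qed.
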